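(* Let $n$ and $k$ be integers with $1\le k\le n-1$, and consider the placement procedure with $n$ balls, $n$ pits and $k$ absent-minded balls described in the context. For $i\in\{1,\ldots,n\}$ let $A_i$ be the event that ball $i$ is placed in pit $i$. Then the events $A_{k+1},\ldots,A_n$ are (mutually) independent.
   Context: Placement procedure: there are $n$ balls numbered $1,\ldots,n$ and a box with $n$ pits numbered $1,\ldots,n$; each pit holds one ball, and the pit assigned to ball $i$ is pit $i$. The first $k$ (absent-minded) balls are distributed at random into $k$ distinct pits, each subset of size $k$ of the $n$ pits having the same probability of being the set of occupied pits. Then the balls $k+1,k+2,\ldots,n$ are placed one after another in this order: ball $i$ takes pit $i$ if that pit is empty; otherwise, conditionally on all previous placements, it takes a pit chosen uniformly at random among all currently empty pits. *)

(* Defs.v *)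
From HB Require Import structures.
From mathcomp Require Import all_boot all_order all_algebra.
From mathcomp Require Import all_classical all_reals all_analysis.

Set Implicit Arguments.
Unset Strict Implicit.
Unset Printing Implicit Defensive.

Import Order.TTheory GRing.Theory Num.Theory.
Local Open Scope classical_set_scope.
Local Open Scope ring_scope.

(* Only meaningful when [P B != 0]. *)
Definition cond_prob d (T : measurableType d) (R : realType)
    (P : probability T R) (A B : set T) : R :=
  fine (P (A `&` B)) / fine (P B).

Definition mutually_independent d (T : measurableType d) (R : realType)
    (P : probability T R) (I : finType) (D : {set I}) (A : I -> set T) : Prop :=
  (forall i, i \in D -> measurable (A i)) /\
  forall J : {set I}, J \subset D ->
    fine (P (\bigcap_(i in [set` J]) A i)) = \prod_(i in J) fine (P (A i)).

(* Balls and pits are numbered from 0: ball (pit) [i : 'I_n] is ball (pit)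
   number [i + 1] of the usual 1-based numbering, so that the absent-minded
   balls are those with [i < k]. *)
Section Placement.
Variables (d : measure_display) (T : measurableType d) (R : realType).
Variables (P : probability T R) (n : nat).
(* [pit i w] is the pit taken by ball [i] in the outcome [w]. *)
Variable pit : 'I_n -> T -> 'I_n.

(* The pits occupied just before ball number [m] (from 0) is placed, if the
   earlier balls [j < m] were put in the pits [h j]. *)
Definition occupied (h : 'I_n -> 'I_n) (m : nat) : {set 'I_n} :=
  [set h j | j : 'I_n & (j < m)%N]%SET.

(* The event that the balls [j < m] were put in the pits [h j]; the values
   of [h] at the other balls are irrelevant. *)
Definition history (h : 'I_n -> 'I_n) (m : nat) : set T :=
  [set w | forall j : 'I_n, (j < m)%N -> pit j w = h j].

(* The law of the assignment of the individual absent-minded balls within the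
   set of pits that they occupy is left arbitrary: only that set is uniform. *)
Record placement_procedure (k : nat) : Prop := PlacementProcedure {
  pit_measurable : forall i p : 'I_n, measurable [set w | pit i w = p];
  absent_minded_distinct :
    P [set w | forall i j : 'I_n, (i < k)%N -> (j < k)%N ->
                 pit i w = pit j w -> i = j] = 1%E;
  absent_minded_uniform : forall S : {set 'I_n}, #|S| = k ->
    fine (P [set w | occupied (pit ^~ w) k = S]) = ('C(n, k)%:R)^-1;
  placed_own : forall (i : 'I_n) (h : 'I_n -> 'I_n),
    (k <= i)%N -> P (history h i) != 0%E -> i \notin occupied h i ->
    cond_prob P [set w | pit i w = i] (history h i) = 1;
  placed_uniform : forall (i : 'I_n) (h : 'I_n -> 'I_n),
    (k <= i)%N -> P (history h i) != 0%E -> i \in occupied h i ->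
    forall p : 'I_n, p \notin occupied h i ->
    cond_prob P [set w | pit i w = p] (history h i)
      = (#|~: occupied h i|%:R)^-1 }.

Definition own_pit (i : 'I_n) : set T := [set w | pit i w = i].

End Placement.

(* Main.v *)
Require Import Defs.
From HB Require Import structures.
From mathcomp Require Import all_boot all_order all_algebra.
From mathcomp Require Import all_classical all_reals all_analysis.
From mathcomp Require Import ring zify.

Set Implicit Arguments.
Unset Strict Implicit.
Unset Printing Implicit Defensive.

(** Just before ball [m] is placed, almost surely [m] distinct pits are
    occupied, and these include pits [k], ..., [m - 1]: ball [i] either
    goes to pit [i] or finds it taken.  So the occupied set is determined by its [k] elements
    among the remaining [n - m + k] pits.  The point is that this [k]-element
    set stays uniform, and is independent of which of the balls [k], ...,
    [m - 1] got their own pit.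

    Indeed, suppose this holds before ball [i] is placed.  If pit [i] is empty,
    ball [i] fills it, and the [k] other occupied pits form a uniform subset of
    the pits outside [k], ..., [i].  If pit [i] is taken, the [k - 1] other
    occupied pits form a uniform subset of the same pits, and ball [i] adds to
    it a uniformly chosen new element; the result is again a uniform
    [k]-subset.  So the new set has the same law in both cases, and carries no
    information on whether ball [i] got its own pit, which happens with
    probability [(n - i) / (n - i + k)].

    The induction is [weight_occupied_own]: it computes the joint probability
    that a given set [B] is occupied and that the balls of [J] placed so far
    own their pits, as a product over these balls divided by the binomial
    coefficient.  For [m = n] only [B = setT] is left, which gives the product
    formula, for all [J] and in particular for singletons.
    The argument is carried out on the law of the whole assignment of pits to
    balls, a measure on the finite type [{ffun 'I_n -> 'I_n}]; the step
    rules, given conditionally on a full history, pass to coarser events of the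
    past by [weight_next]. *)

Import Order.TTheory GRing.Theory Num.Theory.
Local Open Scope ring_scope.

(** * The law of a random element of a finite type *)

Section FiniteLaw.
Variables (d : measure_display) (T : measurableType d) (R : realType).
Variables (P : probability T R) (F : finType) (X : T -> F).
Hypothesis measurable_fiber : forall f, measurable [set w | X w = f]%classic.

Definition law (f : F) : R := fine (P [set w | X w = f]%classic).

Lemma law_ge0 f : 0 <= law f.
Proof. exact/fine_ge0/measure_ge0. Qed.

Lemma preimage_fibers (E : pred F) :
  [set w | E (X w)]%classic
    = (\bigcup_(f in [set` E]) [set w | X w = f])%classic.
Proof.
apply/seteqP; split=> [w Ew|w [f Ef /= Xf]] /=; first by exists (X w).
by rewrite Xf.
Qed.

Lemma prob_event (E : pred F) :
  fine (P [set w | E (X w)]%classic) = \sum_(f | E f) law f.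
Proof.
rewrite preimage_fibers measure_fin_bigcup //; last first.
  by move=> f g _ _ [w [/= <- <-]].
rewrite -(@bigfs _ _ _ _ (index_enum F)) ?index_enum_uniq //; last first.
  by move=> f _; rewrite mem_index_enum.
by rewrite /law sum_fine // => f _; exact: fin_num_measure.
Qed.

End FiniteLaw.

(** * Sums of weights over a finite type *)

Section Weight.
Variables (R : realType) (F : finType) (mu : F -> R).

Definition weight (E : pred F) : R := \sum_(f | E f) mu f.

(** Events may be compared on the support of [mu] only, which is how almost
    sure properties of the procedure are used below. *)
Lemma weight_eq (E E' : pred F) :
  (forall f, mu f != 0 -> E f = E' f) -> weight E = weight E'.
Proof.
move=> EE'; rewrite /weight big_mkcond [RHS]big_mkcond.
by apply: eq_bigr => f _; have [->|/EE' ->//] := eqVneq (mu f) 0; case: ifP; case: ifP.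
Qed.

(** An event of full relative weight in [E] contains every point of [E]
    of nonzero weight: the points that it misses have nonnegative weights with
    sum 0. *)
Lemma weight_almost_sure (E E' : pred F) f :
  (forall g, 0 <= mu g) ->
  weight (fun g => E g && E' g) = weight E -> mu f != 0 -> E f -> E' f.
Proof.
move=> mu_ge0; rewrite {2}/weight (bigID E') /= -[LHS]addr0 => /addrI/esym/eqP.
rewrite psumr_eq0 => [/allP/(_ f)|//]; rewrite mem_index_enum => /(_ isT).
by move=> /implyP H /negP f0 Ef; apply/negPn/negP => E'f; apply/f0/H; rewrite Ef.
Qed.

End Weight.

(** * Occupied pits *)

Section Occupied.
Variable n : nat.
Local Notation state := {ffun 'I_n -> 'I_n}.

Definition agree (m : nat) (f : state) : pred state :=
  fun g => [forall j : 'I_n, (j < m)%N ==> (g j == f j)].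

Lemma agreeP m (f g : state) :
  reflect (forall j : 'I_n, (j < m)%N -> g j = f j) (agree m f g).
Proof.
apply: (iffP forallP) => fg j; first by move=> jm; apply/eqP/(implyP (fg j)).
by apply/implyP => jm; apply/eqP/fg.
Qed.

Lemma agree_refl m f : agree m f f.
Proof. exact/agreeP. Qed.

Lemma card_ord_lt m : (m <= n)%N -> #|[set j : 'I_n | (j < m)%N]%SET| = m.
Proof.
move=> mn; rewrite -[RHS]card_ord -[RHS](card_imset predT (f := widen_ord mn)).
  apply: eq_card => j; rewrite inE; apply/idP/imsetP => [jm|[l _ ->]] /=.
    by exists (Ordinal jm) => //; apply/val_inj.
  exact: (ltn_ord l).
by move=> x y /(congr1 val) /= xy; apply/val_inj.
Qed.

Lemma mem_occupied (f : 'I_n -> 'I_n) m (j : 'I_n) : (j < m)%N -> f j \in occupied f m.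
Proof. by move=> jm; apply/imsetP; exists j; rewrite ?inE. Qed.

Lemma occupiedS (f : 'I_n -> 'I_n) (i : 'I_n) :
  occupied f i.+1 = (f i |: occupied f i)%SET.
Proof.
apply/setP => p; rewrite !inE; apply/imsetP/orP => [[j]|].
  rewrite inE ltnS leq_eqVlt => /orP[/eqP/val_inj -> -> |ji ->].
    by left.
  by right; exact: mem_occupied.
case=> [/eqP -> |/imsetP[j]]; first by exists i; rewrite // inE.
by rewrite inE => ji ->; exists j; rewrite // inE ltnW.
Qed.

Lemma occupied_agree m (f g : state) : agree m f g -> occupied f m = occupied g m.
Proof.
move=> /agreeP fg; apply/setP => p.
by apply/imsetP/imsetP => -[j]; rewrite inE => jm ->; exists j; rewrite ?inE // fg.
Qed.

Lemma card_occupied_le (f : 'I_n -> 'I_n) m : (m <= n)%N -> (#|occupied f m| <= m)%N.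
Proof. by move=> mn; rewrite -[leqRHS](card_ord_lt mn) leq_imset_card. Qed.

Lemma occupied_mono (f : 'I_n -> 'I_n) m m' : (m <= m')%N ->
  occupied f m \subset occupied f m'.
Proof.
move=> mm'; apply/fintype.subsetP => p /imsetP[j]; rewrite inE => jm ->.
exact/mem_occupied/(leq_trans jm).
Qed.

End Occupied.

(** * The law of the occupied set *)

Section FinitePlacement.
Variables (R : realType) (n : nat).
Local Notation state := {ffun 'I_n -> 'I_n}.
Variable mu : state -> R.
Hypothesis mu_ge0 : forall f, 0 <= mu f.
Local Notation pr := (weight mu).

(** Passage from full histories to an arbitrary event [G] of the past of ball
    [i]: such an event is a disjoint union of histories, and a conditional
    probability which is the same on all of them is that given [G]. *)
Lemma weight_next (i p : 'I_n) (c : R) (G : pred state) :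
  (forall f g, agree i f g -> G f = G g) ->
  (forall f, G f -> pr (fun g => agree i f g && (g i == p))
                    = c * pr (agree i f)) ->
  pr (fun f => G f && (f i == p)) = c * pr G.
Proof.
move=> Gi Gc.
(* [r f] is a canonical representative of the history of [f]: the balls from
   [i] on are all sent to an arbitrary pit. *)
pose r (f : state) : state := [ffun j : 'I_n => if (j < i)%N then f j else i].
have rr f : r (r f) = r f by apply/ffunP => j; rewrite !ffunE; case: (j < i)%N.
have agree_r f : agree i f (r f) by apply/agreeP => j ji; rewrite ffunE ji.
have split_by_r (E : pred state) :
    pr (fun f => G f && E f) =
    \sum_(h | G h && (r h == h)) pr (fun f => agree i h f && E f).
  rewrite /weight (partition_big r (fun h => G h && (r h == h))) /=; last first.
    by move=> f /andP[Gf _]; rewrite rr eqxx -(Gi _ _ (agree_r f)) Gf.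
  apply: eq_bigr => h /andP[Gh /eqP rh]; apply: eq_bigl => f.
  rewrite andbAC; congr andb; apply/idP/idP => [/andP[_ /eqP <-]|hf].
    by apply/agreeP => j ji; rewrite ffunE ji.
  rewrite -(Gi _ _ hf) Gh -rh; apply/eqP/ffunP => j; rewrite !ffunE.
  by case: ifP => // ji; exact: (agreeP _ _ _ hf).
rewrite split_by_r.
have -> : pr G = pr (fun f => G f && true).
  by apply: eq_bigl => f; rewrite andbT.
rewrite split_by_r mulr_sumr; apply: eq_bigr => h /andP[Gh _].
by rewrite Gc //; congr (_ * _); apply: eq_bigl => f; rewrite andbT.
Qed.

Variable k : nat.
Hypothesis absent_injective : forall f, mu f != 0 ->
  {in [pred j : 'I_n | (j < k)%N] &, injective f}.
Hypothesis absent_uniform : forall S : {set 'I_n}, #|S| = k ->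
  pr (fun f => occupied f k == S) = ('C(n, k)%:R)^-1.
Hypothesis own_step : forall (i : 'I_n) (f : state), (k <= i)%N -> i \notin occupied f i ->
  pr (fun g => agree i f g && (g i == i)) = pr (agree i f).
Hypothesis displaced_step : forall (i p : 'I_n) (f : state), (k <= i)%N ->
  i \in occupied f i -> p \notin occupied f i ->
  pr (fun g => agree i f g && (g i == p))
    = (#|~: occupied f i|%SET%:R)^-1 * pr (agree i f).

Lemma support_own (f : state) (i : 'I_n) : mu f != 0 -> (k <= i)%N ->
  i \notin occupied f i -> f i = i.
Proof.
move=> f0 ki iO; apply/eqP.
exact: (weight_almost_sure mu_ge0 (own_step ki iO) f0 (agree_refl i f)).
Qed.

(** In the displaced case the probabilities [#|~: occupied f i|^-1] of the
    empty pits already sum to 1, so nothing is left for the occupied ones. *)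
Lemma support_empty (f : state) (i : 'I_n) : mu f != 0 -> (k <= i)%N ->
  f i \notin occupied f i.
Proof.
move=> f0 ki; case: (boolP (i \in occupied f i)) => [iO|iO]; last first.
  by rewrite (support_own f0).
apply: (weight_almost_sure (E := agree i f)
         (E' := fun g => g i \notin occupied f i) mu_ge0 _ f0 (agree_refl i f)).
rewrite {1}/weight (partition_big (fun g : state => g i)
  (fun p => p \in ~: occupied f i)%SET) /=; last first.
  by move=> g /andP[_]; rewrite inE.
transitivity (\sum_(p in (~: occupied f i)%SET)
   (#|~: occupied f i|%SET%:R)^-1 * pr (agree i f)).
  apply: eq_bigr => p; rewrite inE => pO; rewrite -(displaced_step ki iO pO).
  apply: eq_bigl => g; case: (eqVneq (g i) p) => [->|]; last by rewrite !andbF.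
  by rewrite pO !andbT.
rewrite sumr_const -mulrnAl -[X in X * _]mulr_natr mulVf ?mul1r //.
rewrite pnatr_eq0 -lt0n -subn_gt0 cardsCs finset.setCK card_ord.
rewrite subn0 subn_gt0.
by apply: leq_ltn_trans (ltn_ord i); apply/card_occupied_le/ltnW.
Qed.

Lemma support_injective (f : state) : mu f != 0 -> injective f.
Proof.
move=> f0.
have lt_neq (i j : 'I_n) : (i < j)%N -> f i != f j.
  move=> ij; case: (ltnP j k) => [jk|kj].
    apply/eqP => /(absent_injective f0); rewrite !inE jk (ltn_trans ij jk).
    by move=> /(_ isT isT) eij; rewrite eij ltnn in ij.
  apply: contraNneq (support_empty f0 kj) => <-; exact: mem_occupied.
move=> i j fij; apply/val_inj; apply/eqP; rewrite eqn_leq.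
by case: ltngtP => // /lt_neq; rewrite fij eqxx.
Qed.

Lemma support_filled (f : state) (i : 'I_n) : mu f != 0 -> (k <= i)%N ->
  i \in occupied f i.+1.
Proof.
move=> f0 ki; rewrite occupiedS !inE.
case: (boolP (i \in occupied f i)) => iO; first by rewrite orbT.
by rewrite (support_own f0 ki iO) eqxx.
Qed.

Variable J : {set 'I_n}.

Definition own_before (m : nat) (f : state) : bool :=
  [forall j in J, (j < m)%N ==> (f j == j)].

Lemma own_beforeP m (f : state) :
  reflect (forall j, j \in J -> (j < m)%N -> f j = j) (own_before m f).
Proof.
apply: (iffP forall_inP) => H j jJ; first by move=> jm; apply/eqP/(implyP (H j jJ)).
by apply/implyP => jm; apply/eqP/H.
Qed.

Lemma own_beforeS (i : 'I_n) (f : state) :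
  own_before i.+1 f = own_before i f && ((i \in J) ==> (f i == i)).
Proof.
apply/own_beforeP/andP => [H|[/own_beforeP H /implyP Hi] j jJ].
  split; first by apply/own_beforeP => j jJ ji; apply: H => //; apply: ltnW.
  by apply/implyP => iJ; apply/eqP/H.
rewrite ltnS leq_eqVlt => /orP[/eqP/val_inj ji|ji]; last exact: H.
by subst j; apply/eqP/Hi.
Qed.

Lemma own_before_agree m (f g : state) : agree m f g -> own_before m f = own_before m g.
Proof.
move=> /agreeP fg.
by apply/own_beforeP/own_beforeP => H j jJ jm; have := H j jJ jm; rewrite fg.
Qed.

(** The pits of [B] that ball [i] may have taken when [B] is the occupied set
    right after its placement: pits [k], ..., [i - 1] were filled before, and a
    ball of [J] has to be in its own pit. *)
Definition admissible (B : {set 'I_n}) (i : 'I_n) : pred 'I_n :=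
  fun p => [&& p \in B, ~~ (k <= p < i)%N & (i \in J) ==> (p == i)].

(** Decomposition along the pit [p] of ball [i].  Almost surely [p] was empty,
    so that the previous occupied set is [B :\ p], while pits [k], ..., [i - 1]
    were already filled, so that [p] is none of them. *)
Lemma weight_split (B : {set 'I_n}) (i : 'I_n) : (k <= i)%N ->
  pr (fun f => (occupied f i.+1 == B) && own_before i.+1 f) =
  \sum_(p | admissible B i p)
    pr (fun f => (occupied f i == B :\ p)%SET && own_before i f && (f i == p)).
Proof.
move=> ki; rewrite {1}/weight (partition_big (fun f : state => f i) predT) //=.
rewrite [RHS]big_mkcond; apply: eq_bigr => p _.
set E := (X in \sum_(f | X f) _); rewrite -/(pr E) {}/E.
case: ifPn => [/and3P[pB pki piJ]|pN].
  apply: weight_eq => f f0.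
  case: (eqVneq (f i) p) => [fip|_]; last by rewrite !andbF.
  rewrite !andbT own_beforeS fip piJ andbT; congr andb.
  have := support_empty f0 ki; rewrite fip occupiedS fip => pO.
  by apply/eqP/eqP => [<-|->]; rewrite ?finset.setU1K ?finset.setD1K.
rewrite (weight_eq (E' := pred0)) ?/weight ?big_pred0_eq // => f f0 /=.
apply: contraNF pN => /andP[/andP[/eqP OB]]; rewrite own_beforeS => /andP[_ iJ] /eqP fip.
rewrite /admissible -OB -fip mem_occupied //= iJ andbT.
apply: contraNN (support_empty f0 ki) => /andP[kp pi].
by apply: (fintype.subsetP (occupied_mono f pi)); exact: support_filled.
Qed.

(** Of the [i.+1] pits of [B], exactly [i.+1 - k] are pits [k], ..., [i]. *)
Lemma card_admissible (B : {set 'I_n}) (i : 'I_n) : (k <= i)%N -> i \notin J ->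
  #|B| = i.+1 -> (forall j : 'I_n, (k <= j < i.+1)%N -> j \in B) ->
  #|[pred p | admissible B i p & p != i]| = k.
Proof.
move=> ki iJ cB Bi.
pose I m := [set j : 'I_n | (j < m)%N]%SET.
have kn : (k <= n)%N by rewrite ltnW // (leq_ltn_trans ki).
have sub : (I k \subset I i.+1)%SET.
  by apply/fintype.subsetP => j; rewrite !inE => jk; rewrite ltnS (leq_trans (ltnW jk)).
transitivity #|(B :\: (I i.+1 :\: I k))%SET|.
  apply: eq_card => p; rewrite !inE /admissible (negbTE iJ) /= -leqNgt andbT.
  case: (p \in B); rewrite /= ?andbF // andbT ltnS.
  rewrite -[(p == i)]/(nat_of_ord p == nat_of_ord i); lia.
rewrite cardsD (finset.setIidPr _) ?cardsD ?(finset.setIidPr sub).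
  rewrite cB /I !card_ord_lt // ?(ltn_ord i) //; lia.
by apply/fintype.subsetP => j; rewrite !inE -leqNgt => /Bi.
Qed.

(** The key induction.  For [m = k] this is the uniformity of the set occupied
    by the absent-minded balls.  In the step, the term [p = i] of
    [weight_split] contributes the inductive value [v], since ball [i] then
    finds its own pit empty; every other [p] contributes [v / (n - i)], since
    then pit [i] is in [B :\ p] and there are [n - i] empty pits.  There are no
    other [p] if [i] is in [J], and [k] of them otherwise, so the sum is [v] or
    [v * (n - i + k) / (n - i)].  As the binomial coefficient is itself
    multiplied by [(n - i) / (n - i + k)] when [m] goes from [i] to [i.+1],
    this is exactly the expected factor in both cases. *)
Lemma weight_occupied_own (m : nat) : (k <= m <= n)%N ->
  (forall j, j \in J -> (k <= j)%N) ->
  forall B : {set 'I_n}, #|B| = m ->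
  (forall j : 'I_n, (k <= j < m)%N -> j \in B) ->
  pr (fun f => (occupied f m == B) && own_before m f) =
  (\prod_(j in J | (j < m)%N) ((n - j)%:R / (n - j + k)%:R))
    / ('C(n - m + k, k)%:R).
Proof.
move=> /andP[km mn] Jk; rewrite -(subnKC km) in mn *.
elim: (m - k)%N mn => [|l].
  rewrite addn0 => kn B cB Bm.
  rewrite big_pred0 ?mul1r ?subnK // => [|j]; last first.
    by case: (boolP (j \in J)) => // /Jk kj; rewrite ltnNge kj.
  rewrite -(absent_uniform cB); apply: eq_bigl => f.
  by case: eqP => //= _; apply/own_beforeP => j /Jk kj; rewrite ltnNge kj.
rewrite addnS => IH mn B cB Bm.
pose i := Ordinal mn.
have ki : (k <= i)%N by exact: leq_addr.
rewrite -[(k + l)%N]/(nat_of_ord i) in IH cB Bm *.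
have iB : i \in B by apply: Bm; rewrite ki /=.
set W := \prod_(j in J | (j < i)%N) _ in IH *.
have prodS : \prod_(j in J | (j < i.+1)%N) ((n - j)%:R / (n - j + k)%:R) =
    (if i \in J then (n - i)%:R / (n - i + k)%:R else 1) * W.
  case: ifPn => iJ; last first.
    rewrite mul1r; apply: eq_bigl => j; rewrite ltnS leq_eqVlt.
    case: (boolP (j \in J)) => //= jJ; case: eqP => // ji.
    by rewrite -(_ : j = i) ?jJ // in iJ; exact/val_inj.
  rewrite (bigD1 i) /=; last by rewrite iJ /=.
  congr (_ * _); apply: eq_bigl => j.
  rewrite -[j == i]/(nat_of_ord j == nat_of_ord i).
  by case: (j \in J) => //=; lia.
rewrite (@weight_split B i) //.
have Qi : admissible B i i by rewrite /admissible iB ltnn andbF eqxx implybT.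
transitivity (\sum_(p | admissible B i p)
  (if p == i then 1 else (n - i)%:R^-1) * (W / 'C(n - i + k, k)%:R)).
  apply: eq_bigr => p /and3P[pB pki _].
  have cBp : #|(B :\ p)%SET| = i by have := cardsD1 p B; rewrite pB cB => -[].
  rewrite -(IH (ltnW mn) _ cBp); last first.
    move=> j kji; rewrite !inE Bm; last by lia.
    by rewrite andbT; apply: contraNneq pki => <-.
  apply: weight_next => [f g fg|f /andP[/eqP OB _]].
    by rewrite (occupied_agree fg) (own_before_agree fg).
  case: eqP => [pi|/eqP pi]; first rewrite pi.
    by rewrite mul1r own_step // OB pi !inE eqxx.
  rewrite displaced_step // ?OB ?inE ?eqxx //; last by rewrite eq_sym pi.
  by rewrite cardsCs finset.setCK card_ord cBp.
rewrite -mulr_suml (bigD1 i) //= eqxx.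
under eq_bigr => p /andP[_ /negbTE ->] do [].
rewrite sumr_const.
have lin : (i < n)%N := ltn_ord i.
have [N nN] : exists N, (n - i = N.+1)%N by exists (n - i).-1; move: lin; lia.
have -> : (n - i.+1 = N)%N by lia.
have bin : (N.+1 + k)%:R * 'C(N + k, k)%:R = N.+1%:R * 'C(N.+1 + k, k)%:R :> R.
  by rewrite -!natrM; congr (_%:R); rewrite addSn mul_bin_down; congr (_ * _)%N; lia.
have binN M : 'C(M + k, k)%:R != 0 :> R.
  by rewrite pnatr_eq0 -lt0n bin_gt0 leq_addl.
have bM : 'C(N.+1 + k, k)%:R = (N.+1 + k)%:R * 'C(N + k, k)%:R / N.+1%:R :> R.
  by rewrite bin mulrC mulKf // pnatr_eq0.
have := binN N; rewrite nN bM.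
rewrite prodS; case: (boolP (i \in J)) => iJ b0.
  rewrite (eq_card0 (A := [pred p | _])) => [|p]; last first.
    by rewrite !inE /admissible iJ /=; case: eqP; rewrite ?andbF.
  rewrite nN mulr0n addr0; field.
  by rewrite b0 -[1]/(1%:R) -!natrD !pnatr_eq0.
rewrite card_admissible //.
rewrite -mulr_natr; field.
by rewrite b0 -[1]/(1%:R) -!natrD !pnatr_eq0.
Qed.

Lemma weight_own : (forall j, j \in J -> (k <= j)%N) -> (k <= n)%N ->
  pr (fun f => [forall j in J, f j == j]) =
  \prod_(j in J) ((n - j)%:R / (n - j + k)%:R).
Proof.
move=> Jk kn; have := weight_occupied_own (m := n) _ Jk (B := [set: 'I_n]%SET).
rewrite kn leqnn cardsT card_ord subnn add0n binn divr1 => /(_ isT erefl).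
have -> : \prod_(j in J | (j < n)%N) ((n - j)%:R / (n - j + k)%:R) =
   \prod_(j in J) ((n - j)%:R / (n - j + k)%:R) :> R.
  by apply: eq_bigl => j; rewrite ltn_ord andbT.
move=> <- => [|j _]; last by rewrite inE.
apply: weight_eq => f f0.
have -> : occupied f n = [set: 'I_n]%SET.
  have [g fg gf] := injF_bij (support_injective f0).
  by apply/setP => p; rewrite inE -[p]gf mem_occupied.
by rewrite eqxx /=; apply: eq_forallb => j; rewrite ltn_ord.
Qed.

End FinitePlacement.

(** * From the procedure to the law of its assignment *)

Section Transfer.
Variables (d : measure_display) (T : measurableType d) (R : realType).
Variables (P : probability T R) (n k : nat) (pit : 'I_n -> T -> 'I_n).
Hypothesis hpit : placement_procedure P pit k.

Definition pits (w : T) : {ffun 'I_n -> 'I_n} := [ffun j => pit j w].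

Lemma measurable_pits f : measurable [set w | pits w = f]%classic.
Proof.
have -> : [set w | pits w = f]%classic =
    (\bigcap_(j in [set: 'I_n]) [set w | pit j w = f j])%classic.
  apply/seteqP; split => w /= H; first by move=> j _ /=; rewrite -H ffunE.
  by apply/ffunP => j; rewrite ffunE; exact: H.
by apply: fin_bigcap_measurable => // j _; exact: (pit_measurable hpit).
Qed.

Let mu := law P pits.

Lemma prob_pits (A : set T) (E : pred {ffun 'I_n -> 'I_n}) :
  (forall w, A w <-> E (pits w)) -> fine (P A) = weight mu E.
Proof.
move=> AE; rewrite /weight -(prob_event _ measurable_pits).
by congr (fine (P _)); apply/seteqP; split=> w /AE.
Qed.

Lemma history_agree (f : {ffun 'I_n -> 'I_n}) m w :
  history pit f m w <-> agree m f (pits w).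
Proof.
by split=> [H|/agreeP H j jm]; [apply/agreeP => j jm|have := H j jm]; rewrite ffunE ?H.
Qed.

(** The conditional step rules in product form, where they also hold for
    histories of probability 0. *)
Lemma weight_cond_prob (i p : 'I_n) (f : {ffun 'I_n -> 'I_n}) (c : R) :
  (P (history pit f i) != 0%E ->
   cond_prob P [set w | pit i w = p]%classic (history pit f i) = c) ->
  weight mu (fun g => agree i f g && (g i == p)) = c * weight mu (agree i f).
Proof.
have mu0 g : 0 <= mu g by exact: law_ge0.
have histE := prob_pits (history_agree f i).
have bothE : fine (P ([set w | pit i w = p] `&` history pit f i)%classic) =
    weight mu (fun g => agree i f g && (g i == p)).
  apply: prob_pits => w; rewrite ffunE /=.
  split=> [[-> /history_agree ->]|/andP[/history_agree fw /eqP]] //.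
  by rewrite eqxx.
rewrite /cond_prob histE bothE.
have [w0 _|w0 Hc] := eqVneq (weight mu (agree i f)) 0; last first.
  by rewrite -Hc ?divfK //; apply: contraNneq w0 => H0; rewrite -histE H0.
rewrite w0 mulr0; apply/eqP; rewrite eq_le sumr_ge0 // andbT -w0.
by rewrite /weight [leRHS](bigID (fun g : {ffun _} => g i == p)) /= lerDl sumr_ge0.
Qed.

Lemma prob_own_pits (J : {set 'I_n}) :
  (forall j, j \in J -> (k <= j)%N) -> (k <= n)%N ->
  fine (P (\bigcap_(j in [set` J]) own_pit pit j)%classic) =
  \prod_(j in J) ((n - j)%:R / (n - j + k)%:R).
Proof.
move=> Jk kn.
rewrite -(@weight_own _ _ mu _ k _ _ _ _ J Jk kn).
- apply: prob_pits => w; split=> [H|/forall_inP H j /H /eqP].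
    by apply/forall_inP => j jJ; rewrite ffunE; apply/eqP/H.
  by rewrite ffunE.
- by move=> f; exact: law_ge0.
- move=> f f0.
  (* Injectivity on the absent-minded balls, as a boolean event of full mass. *)
  have H : weight mu (fun g => predT g && [forall i : 'I_n, forall j : 'I_n,
      (i < k)%N ==> (j < k)%N ==> (g i == g j) ==> (i == j)]) = weight mu predT.
    rewrite -(@prob_pits setT predT) // probability_setT.
    rewrite -(absent_minded_distinct hpit); apply/esym/prob_pits => w; split.
      move=> H; apply/forallP => i; apply/forallP => j; rewrite !ffunE.
      apply/implyP => ik; apply/implyP => jk; apply/implyP => /eqP e.
      exact/eqP/H.
    move=> /forallP H i j ik jk e; have /forallP/(_ j) := H i.
    by rewrite !ffunE ik jk e eqxx => /eqP.
  have /forallP inj := weight_almost_sure (law_ge0 P pits) H f0 isT.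
  move=> i j; rewrite !inE => ik jk e; have /forallP/(_ j) := inj i.
  by rewrite ik jk e eqxx => /eqP.
- move=> S cS; rewrite -(absent_minded_uniform hpit cS); apply/esym/prob_pits => w.
  have -> : occupied (pits w) k = occupied (pit ^~ w) k.
    by apply: eq_imset => j; rewrite ffunE.
  by split => [/= ->|/eqP].
- move=> i f ki iO; rewrite -[RHS]mul1r; apply: weight_cond_prob => h0.
  exact: (placed_own hpit).
- move=> i p f ki iO pO; apply: weight_cond_prob => h0.
  exact: (placed_uniform hpit).
Qed.

End Transfer.

Theorem theorem3p2 (R : realType) (d : measure_display) (T : measurableType d)
  (P : probability T R) (n k : nat) (pit : 'I_n -> T -> 'I_n)
  (hk : (1 <= k <= n - 1)%N)
  (hpit : placement_procedure P pit k) :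
  mutually_independent P [set i : 'I_n | (k <= i)%N]%SET (own_pit pit).
Proof.
have kn : (k <= n)%N by lia.
split=> [i _|J /fintype.subsetP Jk]; first exact: (pit_measurable hpit).
have {}Jk j : j \in J -> (k <= j)%N by move=> /Jk; rewrite inE.
rewrite (prob_own_pits hpit Jk kn); apply: eq_bigr => j jJ.
have <- : (\bigcap_(l in [set` [set j]%SET]) own_pit pit l)%classic = own_pit pit j.
  apply/seteqP; split=> [w|w wj l /set1P ->//]; by apply; exact/set1P.
rewrite (prob_own_pits hpit) ?big_set1 // => l /set1P ->; exact: Jk.
Qed.
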